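(* Let $A \subseteq \omega$ be a computably enumerable set. If $A$ is $c_1$-complete then $A$ is $c_{1,N}$-complete.
   Context: $\omega$ is the set of natural numbers and $D_u$ denotes the finite set with canonical index $u$. For sets $X, Y \subseteq \omega$: - A $c$-reduction from $X$ to $Y$ is a (total) computable function $f$ such that for all $x$: $x \in X \iff D_{f(x)} \subseteq Y$. - $X \le_{c_1} Y$ if there is a $c_1$-reduction from $X$ to $Y$, i.e. a $c$-reduction $f$ from $X$ to $Y$ such that $x \neq y$ implies $D_{f(x)} \cap D_{f(y)} = \emptyset$. - $X \le_{c_{1,N}} Y$ if there is a $c_1$-reduction $f$ from $X$ to $Y$ such that the set $R_f = \bigcup_{x \in \omega} D_{f(x)}$ is computable. For a reducibility $r$, a computably enumerable (c.e.) set $A$ is $r$-complete if $B \le_r A$ for every c.e. set $B$. *)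

(* Defs.v *)
From mathcomp Require Import all_boot.
From mathcomp Require Import boolp classical_sets.

Set Implicit Arguments.
Unset Strict Implicit.
Unset Printing Implicit Defensive.

Local Open Scope classical_set_scope.

(* A partial function of arity n is represented by its graph. *)
Definition pfun (n : nat) := n.-tuple nat -> nat -> Prop.

(* h(0, v) = f(v) and h(x + 1, v) = g(x, h(x, v), v). *)
Fixpoint prec_graph n (f : pfun n) (g : pfun n.+2)
    (v : n.-tuple nat) (x : nat) : nat -> Prop :=
  match x with
  | 0 => f v
  | x'.+1 => fun y => exists2 z, prec_graph f g v x' z &
                        g [tuple of x' :: z :: v] y
  end.

(* Kleene's class of partial recursive functions.  The last constructor only
   says that membership depends on the graph up to extensional equality. *)
Inductive partrec : forall n, pfun n -> Prop :=
| partrec_zero : @partrec 0 (fun _ y => y = 0)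
| partrec_succ : @partrec 1 (fun v y => y = (thead v).+1)
| partrec_proj n (i : 'I_n) : @partrec n (fun v y => y = tnth v i)
| partrec_comp m n (f : pfun m) (g : 'I_m -> pfun n) :
    partrec f -> (forall i, partrec (g i)) ->
    @partrec n (fun v y => exists2 w : m.-tuple nat,
                  forall i, g i v (tnth w i) & f w y)
| partrec_prec n (f : pfun n) (g : pfun n.+2) :
    partrec f -> partrec g ->
    @partrec n.+1 (fun v => prec_graph f g [tuple of behead v] (thead v))
| partrec_mu n (f : pfun n.+1) :
    partrec f ->
    @partrec n (fun v y => f [tuple of y :: v] 0 /\
                  forall z, z < y -> exists k, f [tuple of z :: v] k.+1)
| partrec_ext n (f g : pfun n) :
    partrec f -> (forall v y, f v y <-> g v y) -> partrec g.

Lemma partrec_functional n (f : pfun n) : partrec f ->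
  forall v y1 y2, f v y1 -> f v y2 -> y1 = y2.
Proof.
elim=> {n f}.
- by move=> v y1 y2 -> ->.
- by move=> v y1 y2 -> ->.
- by move=> n i v y1 y2 -> ->.
- move=> m n f g _ IHf _ IHg v y1 y2 [w1 g1 f1] [w2 g2 f2].
  have w12 : w1 = w2.
    by apply: eq_from_tnth => i; apply: IHg (g1 i) (g2 i).
  by rewrite w12 in f1; apply: IHf f1 f2.
- move=> n f g _ IHf _ IHg v y1 y2.
  elim: (thead v) y1 y2 => [|x IHx] y1 y2 /=; first exact: IHf.
  move=> [z1 h1 g1] [z2 h2 g2].
  by rewrite (IHx _ _ h1 h2) in g1; apply: IHg g1 g2.
- move=> n f _ IHf v y1 y2 [f1 m1] [f2 m2].
  case: (ltngtP y1 y2) => // [/m2|/m1] [k fk].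
    by have := IHf _ _ _ f1 fk.
  by have := IHf _ _ _ f2 fk.
- by move=> n f g _ IHf fg v y1 y2 /fg f1 /fg f2; apply: IHf f1 f2.
Qed.

Definition computable (f : nat -> nat) : Prop :=
  @partrec 1 (fun v y => y = f (thead v)).

Definition computable_set (X : set nat) : Prop :=
  computable (fun x => nat_of_bool `[< X x >]).

Definition ce (X : set nat) : Prop :=
  exists2 f : pfun 1, partrec f & X = [set x | exists y, f [tuple x] y].

(* The finite set with canonical index u = \sum_(x in D u) 2 ^ x: x belongs to
   it when the binary digit of u of weight 2 ^ x is 1. *)
Definition D (u : nat) : set nat := [set x | odd (u %/ 2 ^ x)].

Definition c_reduction (f : nat -> nat) (X Y : set nat) : Prop :=
  computable f /\ forall x, X x <-> D (f x) `<=` Y.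

Definition c1_reduction (f : nat -> nat) (X Y : set nat) : Prop :=
  c_reduction f X Y /\
  forall x y, x <> y -> D (f x) `&` D (f y) = set0.

Definition c1_le (X Y : set nat) : Prop :=
  exists f, c1_reduction f X Y.

Definition c1N_le (X Y : set nat) : Prop :=
  exists2 f, c1_reduction f X Y & computable_set (\bigcup_x D (f x)).

Definition complete (r : set nat -> set nat -> Prop) (A : set nat) : Prop :=
  ce A /\ forall B, ce B -> r B A.

(* Main.v *)
Require Import Defs.
From mathcomp Require Import all_boot.
From mathcomp Require Import boolp classical_sets.
From mathcomp Require Import zify.

(* Let pi be computable with infinite fibres.  For B c.e. c_1-reduce to A, by f,
   the cylinder { n | pi n \in B }.  The sets D (f n) with pi n = x are pairwise
   disjoint, so among any x + 2 of them one (maybe empty) misses {0, .., x};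
   choose it as D (g x).  Then m \in R_g only needs D (g x) for x < m. *)

Set Implicit Arguments.
Unset Strict Implicit.
Unset Printing Implicit Defensive.

Local Open Scope classical_set_scope.

(** * Closure properties of total computable functions *)

Definition total_rec n (F : n.-tuple nat -> nat) := partrec (fun v y => y = F v).

Definition computable2 (f : nat -> nat -> nat) :=
  @total_rec 2 (fun v => f (tnth v ord0) (tnth v (inord 1))).

Definition computable3 (f : nat -> nat -> nat -> nat) :=
  @total_rec 3 (fun v => f (tnth v ord0) (tnth v (inord 1)) (tnth v (inord 2))).

Lemma total_rec_eq n (F G : n.-tuple nat -> nat) :
  total_rec F -> F =1 G -> total_rec G.
Proof. by move=> cF FG; apply: partrec_ext cF _ => v y; rewrite FG. Qed.

Lemma computable_eq f g : computable f -> f =1 g -> computable g.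
Proof. by move=> cf fg; apply: total_rec_eq cf _ => v; apply: fg. Qed.

Lemma computable2_eq f g : computable2 f -> f =2 g -> computable2 g.
Proof. by move=> cf fg; apply: total_rec_eq cf _ => v; apply: fg. Qed.

(** Total inner functions leave one possible tuple of intermediate values, so the existential of
    [partrec_comp] disappears. *)
Lemma partrec_comp_total m n (f : pfun m) (G : 'I_m -> n.-tuple nat -> nat) :
  partrec f -> (forall i, total_rec (G i)) ->
  partrec (fun v y => f [tuple G i v | i < m] y).
Proof.
move=> cf cG; apply: partrec_ext (partrec_comp cf cG) _ => v y; split.
  case=> w Gw; suff -> : w = [tuple G i v | i < m] by [].
  by apply: eq_from_tnth => i; rewrite tnth_mktuple.
by move=> fy; exists [tuple G i v | i < m] => // i; rewrite tnth_mktuple.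
Qed.

Lemma total_rec_comp1 n f (F : n.-tuple nat -> nat) :
  computable f -> total_rec F -> total_rec (fun v => f (F v)).
Proof.
move=> cf cF; have cF1 (i : 'I_1) : total_rec F by [].
apply: partrec_ext (partrec_comp_total cf cF1) _ => v y.
by rewrite /thead tnth_mktuple.
Qed.

Lemma total_rec_comp2 n f (F G : n.-tuple nat -> nat) :
  computable2 f -> total_rec F -> total_rec G ->
  total_rec (fun v => f (F v) (G v)).
Proof.
move=> cf cF cG.
(* The default value of [nth] is never reached, since [i < 2]. *)
have cFG (i : 'I_2) : total_rec (nth F [:: F; G] i) by case: i => [[|[|]]].
apply: partrec_ext (partrec_comp_total cf cFG) _ => v y.
by rewrite !tnth_mktuple !inordK.
Qed.

Lemma total_rec_proj n (i : 'I_n) : total_rec (fun v => tnth v i).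
Proof. exact: partrec_proj. Qed.

Lemma computable_id : computable id.
Proof. exact: (@total_rec_proj 1 ord0). Qed.

Lemma computable_succ : computable succn.
Proof. exact: partrec_succ. Qed.

Lemma total_rec_const n c : total_rec (fun _ : n.-tuple nat => c).
Proof.
elim: c => [|c IHc]; last exact: total_rec_comp1 computable_succ IHc.
(* [partrec_zero] has arity 0; composing it with the empty family raises it to arity [n]. *)
have c0 (i : 'I_0) : total_rec (fun _ : n.-tuple nat => 0) by case: i.
exact: partrec_comp_total partrec_zero c0.
Qed.

Lemma computable2_rec (h : nat -> nat -> nat) F G :
  computable F -> computable3 G ->
  (forall a, h 0 a = F a) -> (forall x a, h x.+1 a = G x (h x a) a) ->
  computable2 h.
Proof.
move=> cF cG h0 hS; apply: partrec_ext (partrec_prec cF cG) _ => v y.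
have -> : tnth v (inord 1) = thead [tuple of behead v].
  by rewrite /thead tnth_behead; congr tnth; apply: val_inj; rewrite /= inordK.
rewrite -/(thead v); set w := [tuple of behead v].
elim: (thead v) y => [|x IHx] y /=; first by rewrite h0.
rewrite hS; split.
  case=> z /IHx ->; rewrite !(tnth_nth 0) !inordK //= => ->.
  by rewrite /thead (tnth_nth 0).
move=> ->; exists (h x (thead w)); first exact/IHx.
by rewrite !(tnth_nth 0) !inordK //= /thead (tnth_nth 0).
Qed.

(** Totality of [p] makes the definedness clause of [partrec_mu] harmless: below the least zero,
    every value is a successor. *)
Lemma computable_mu (p : nat -> nat -> nat) k :
  computable2 p -> (forall x, p (k x) x = 0) ->
  (forall x z, z < k x -> 0 < p z x) -> computable k.
Proof.
move=> cp pk k_min; apply: partrec_ext (partrec_mu cp) _ => v y.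
have pE z : p (tnth [tuple of z :: v] ord0) (tnth [tuple of z :: v] (inord 1))
          = p z (thead v).
  by rewrite !(tnth_nth 0) inordK //= /thead (tnth_nth 0).
split=> [[]|->].
  rewrite pE => py y_min; case: (ltngtP y (k (thead v))) => //.
    by move/k_min; rewrite -py ltnn.
  by move/y_min=> [j]; rewrite pE pk.
split=> [|z z_lt]; first by rewrite pE pk.
by exists (p z (thead v)).-1; rewrite pE prednK // k_min.
Qed.

Lemma computable2_swap f : computable2 f -> computable2 (fun x y => f y x).
Proof.
move=> cf; exact: total_rec_comp2 cf (total_rec_proj _) (total_rec_proj _).
Qed.

Lemma computable2_iter f : computable f -> computable2 (fun x a => iter x f a).
Proof.
move=> cf; apply: (@computable2_rec _ id (fun _ z _ => f z)) => //.
  exact: computable_id.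
exact: total_rec_comp1 cf (total_rec_proj _).
Qed.

Lemma computable_rec h G :
  computable2 G -> (forall x, h x.+1 = G x (h x)) -> computable h.
Proof.
move=> cG hS.
(* A dummy parameter makes [computable2_rec] applicable; it is afterwards filled with the argument
   itself. *)
have ch : computable2 (fun x _ => h x).
  apply: (@computable2_rec _ (fun=> h 0) (fun x z _ => G x z)) => //.
    exact: total_rec_const.
  exact: total_rec_comp2 cG (total_rec_proj _) (total_rec_proj _).
exact: total_rec_comp2 ch (total_rec_proj _) (total_rec_proj ord0).
Qed.

(** * Arithmetic, digits of canonical indices, and a decoding with infinite fibres *)

Lemma computable_pred : computable predn.
Proof.
by apply: (@computable_rec _ (fun x _ => x)) => //; exact: total_rec_proj.
Qed.

Lemma computable2_add : computable2 addn.
Proof.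
apply: computable2_eq (computable2_iter computable_succ) _ => x y.
by rewrite iter_succn addnC.
Qed.

Lemma computable2_sub : computable2 subn.
Proof.
apply: computable2_eq (computable2_swap (computable2_iter computable_pred)) _.
by move=> x y; exact: iter_predn.
Qed.

Lemma computable2_mul : computable2 muln.
Proof.
apply: (@computable2_rec _ (fun=> 0) (fun _ z a => a + z)) => //.
  exact: total_rec_const.
exact: total_rec_comp2 computable2_add (total_rec_proj _) (total_rec_proj _).
Qed.

Lemma computable_square : computable (fun x => x ^ 2).
Proof.
exact: (total_rec_comp2 computable2_mul (total_rec_proj ord0) (total_rec_proj _)).
Qed.

Lemma computable_odd : computable odd.
Proof.
apply: (@computable_rec _ (fun _ z => 1 - z)) => [|x /=]; last by case: odd.
exact: total_rec_comp2 computable2_sub (total_rec_const _ 1) (total_rec_proj _).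
Qed.

Lemma computable_half : computable half.
Proof.
apply: (@computable_rec _ (fun x z => odd x + z)) => [|x].
  exact: total_rec_comp2 computable2_add
    (total_rec_comp1 computable_odd (total_rec_proj _)) (total_rec_proj _).
exact: uphalf_half.
Qed.

Lemma computable2_mem_D : computable2 (fun x u => odd (u %/ 2 ^ x)).
Proof.
suff cshift : computable2 (fun x u => u %/ 2 ^ x).
  exact: total_rec_comp1 computable_odd cshift.
(* Dividing by [2 ^ x] is halving [x] times, so iteration suffices. *)
apply: (computable2_eq (computable2_iter computable_half)) => x u.
elim: x => [|x IHx]; first by rewrite divn1.
by rewrite iterS IHx -divn2 -divnMA -expnSr.
Qed.

(** Used as a bounded quantifier: a sum of digits vanishes exactly when all of them do. *)
Lemma computable2_sum f :
  computable2 f -> computable2 (fun n a => \sum_(i < n) f i a).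
Proof.
move=> cf; apply: (@computable2_rec _ (fun=> 0) (fun x z a => z + f x a)).
- exact: total_rec_const.
- exact: total_rec_comp2 computable2_add (total_rec_proj _)
    (total_rec_comp2 cf (total_rec_proj _) (total_rec_proj _)).
- by move=> a; rewrite big_ord0.
- by move=> x a; rewrite big_ord_recr.
Qed.

(* [(x + i) ^ 2 <= code x i < (x + i).+1 ^ 2], so [decode] below recovers [x] by
   subtracting the largest square. *)
Definition code x i := (x + i) ^ 2 + x.

Lemma computable2_code : computable2 code.
Proof.
exact: total_rec_comp2 computable2_add
  (total_rec_comp1 computable_square
    (total_rec_comp2 computable2_add (total_rec_proj _) (total_rec_proj _)))
  (total_rec_proj _).
Qed.

(** With [codeK], this makes every fibre of [decode] infinite. *)
Lemma code_inj x : injective (code x).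
Proof. by move=> i j /addIn/eqP; rewrite eqn_exp2r // eqn_add2l => /eqP. Qed.

Lemma sqrt_subproof n : exists s, n < s.+1 ^ 2.
Proof. by exists n; rewrite -mulnn leq_pmulr. Qed.

(** The integer part of the square root, as a least witness so that minimization computes it. *)
Definition nat_sqrt n := ex_minn (sqrt_subproof n).

Lemma computable_nat_sqrt : computable nat_sqrt.
Proof.
apply: (@computable_mu (fun s n => n.+1 - s.+1 ^ 2)).
- exact: total_rec_comp2 computable2_sub
    (total_rec_comp1 computable_succ (total_rec_proj _))
    (total_rec_comp1 computable_square
       (total_rec_comp1 computable_succ (total_rec_proj _))).
- by move=> n; apply/eqP; rewrite subn_eq0 /nat_sqrt; case: ex_minnP.
- move=> n z; rewrite /nat_sqrt; case: ex_minnP => s _ s_min.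
  by rewrite subn_gt0 ltnS !ltnNge => /negP h; apply/negP => /s_min.
Qed.

Definition decode n := n - nat_sqrt n ^ 2.

Lemma computable_decode : computable decode.
Proof.
exact: total_rec_comp2 computable2_sub (total_rec_proj ord0)
  (total_rec_comp1 computable_square
    (total_rec_comp1 computable_nat_sqrt (total_rec_proj _))).
Qed.

Lemma codeK x i : decode (code x i) = x.
Proof.
rewrite /decode; suff -> : nat_sqrt (code x i) = x + i by rewrite addKn.
rewrite /nat_sqrt; case: ex_minnP => s s_gt s_min.
apply/eqP; rewrite eqn_leq s_min /=; last first.
  (* Consecutive squares differ by [2 * (x + i) + 1], which exceeds [x]. *)
  by rewrite /code -[(x + i).+1]addn1 sqrnD; lia.
rewrite -ltnS -(@ltn_exp2r _ _ 2) //; apply: leq_ltn_trans s_gt.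
exact: leq_addr.
Qed.

(** * Thinning a reduction from a cylinder, and the theorem *)

Lemma ce_preimage B f : ce B -> computable f -> ce [set n | B (f n)].
Proof.
case=> b cb -> cf; exists (fun v y => b [tuple f (thead v)] y) => //.
have cf1 (i : 'I_1) : total_rec (fun v : 1.-tuple nat => f (thead v)) by [].
apply: partrec_ext (partrec_comp_total cb cf1) _ => v y.
suff -> : [tuple f (thead v) | i < 1] = [tuple f (thead v)] by [].
by apply: eq_from_tnth => i; rewrite tnth_mktuple ord1.
Qed.

(** Counts the elements of [D u] up to [x]; as a number, it can be minimized to zero by
    [computable_mu]. *)
Definition weight_upto x u := \sum_(y < x.+1) odd (u %/ 2 ^ y).

Lemma weight_upto_eq0 x u :
  (weight_upto x u == 0) = [forall y : 'I_x.+1, ~~ odd (u %/ 2 ^ y)].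
Proof.
rewrite /weight_upto sum_nat_eq0.
by apply: eq_forallb => y; rewrite implyTb eqb0.
Qed.

(** Pigeonhole: otherwise, picking an element at most [x] from each of [x + 2] disjoint sets would
    inject ['I_x.+2] into ['I_x.+1]. *)
Lemma disjoint_D_avoid (F : nat -> nat) x :
  (forall i j, i <> j -> D (F i) `&` D (F j) = set0) ->
  exists i, weight_upto x (F i) == 0.
Proof.
move=> disF; apply: contrapT => /forallNP F_low.
have /choice[h hP] (i : 'I_x.+2) : exists y : 'I_x.+1, odd (F i %/ 2 ^ y).
  have /negP := F_low i; rewrite weight_upto_eq0 negb_forall.
  by case/existsP=> y; rewrite negbK; exists y.
suff /leq_card : injective h by rewrite !card_ord ltnn.
move=> i j hij; apply: contrapT => i_neq_j.
have : (D (F i) `&` D (F j)) (h i) by split; rewrite /D /= ?hP // hij hP.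
by rewrite disF // => /val_inj.
Qed.

(** All the numbers [code x i] decode to [x], so any of them may represent [x]; an unbounded search
    finds one whose set has no element up to [x]. *)
Lemma c1_reduction_sparse A B f :
  c1_reduction f [set n | B (decode n)] A ->
  exists2 g, c1_reduction g B A & forall x m, D (g x) m -> x < m.
Proof.
case=> [[cf fP] disf].
have kP x : exists i, weight_upto x (f (code x i)) == 0.
  by apply: disjoint_D_avoid => i j ij; apply: disf => /code_inj.
pose k x := ex_minn (kP x).
have ck : computable k.
  apply: (@computable_mu (fun i x => weight_upto x (f (code x i)))).
  - exact: total_rec_comp2 (computable2_sum computable2_mem_D)
      (total_rec_comp1 computable_succ (total_rec_proj _))
      (total_rec_comp1 cf (total_rec_comp2 computable2_code
         (total_rec_proj _) (total_rec_proj _))).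
  - by move=> x; apply/eqP; rewrite /k; case: ex_minnP.
  - move=> x z; rewrite /k; case: ex_minnP => i _ i_min.
    by rewrite lt0n ltnNge => /negP h; apply/negP => /i_min.
exists (fun x => f (code x (k x))).
  split; first split.
  - exact: total_rec_comp1 cf (total_rec_comp2 computable2_code
      (total_rec_proj ord0) (total_rec_comp1 ck (total_rec_proj _))).
  - by move=> x; rewrite -fP /= codeK.
  (* Representatives of distinct [x] and [y] differ because [decode] separates them, so disjointness
     is inherited from [f]. *)
  - move=> x y xy; apply: disf => /(congr1 decode).
    by rewrite !codeK.
move=> x m Dm; rewrite ltnNge; apply/negP => m_le.
have : weight_upto x (f (code x (k x))) == 0 by rewrite /k; case: ex_minnP.
rewrite weight_upto_eq0 => /forallP/(_ (Ordinal (m_le : m < x.+1)))/negP.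
exact.
Qed.

(** Membership of [m] in the union is decided by the finitely many sets [D (g x)] with [x < m]. *)
Lemma computable_bigcup_D g :
  computable g -> (forall x m, D (g x) m -> x < m) ->
  computable_set (\bigcup_x D (g x)).
Proof.
move=> cg g_gt.
have cs : computable2 (fun n m => \sum_(x < n) odd (g x %/ 2 ^ m)).
  apply: (@computable2_sum (fun x m => odd (g x %/ 2 ^ m))).
  exact: total_rec_comp2 computable2_mem_D (total_rec_proj _)
    (total_rec_comp1 cg (total_rec_proj _)).
(* [1 - (1 - s)] is the sign of [s], turning a count into a truth value. *)
have c : computable (fun m => 1 - (1 - \sum_(x < m) odd (g x %/ 2 ^ m))).
  exact: total_rec_comp2 computable2_sub (total_rec_const _ 1)
    (total_rec_comp2 computable2_sub (total_rec_const _ 1)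
      (total_rec_comp2 cs (total_rec_proj ord0) (total_rec_proj _))).
apply: computable_eq c _ => m.
case: asboolP => [[x _ Dm]|notR].
  by rewrite (bigD1 (Ordinal (g_gt _ _ Dm))) //= Dm.
rewrite big1 // => x _; case: (boolP (odd _)) => // Dm.
by case: notR; exists x.
Qed.

Theorem theorem4p3 (A : set nat) (hA : ce A) :
  complete c1_le A -> complete c1N_le A.
Proof.
move=> [_ complA]; split=> // B ceB.
have [f fP] := complA _ (ce_preimage ceB computable_decode).
have [g gP g_gt] := c1_reduction_sparse fP.
by exists g => //; apply: computable_bigcup_D g_gt; case: gP => [[]].
Qed.
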